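(* Let $T=[a,b]\subset\mathbb{R}$ with $a<b$, let $(M,d)$ be a metric space, and let $\kappa:[0,1]\to[0,1]$ be a continuous, increasing and concave function such that $\kappa(0)=0$, $\kappa(1)=1$, and $\kappa(\tau)/\tau\to\infty$ as $\tau\to+0$. Suppose $\{f_j\}_{j=1}^\infty,\{g_j\}_{j=1}^\infty\subset M^T$ are two sequences of functions such that (a) $\{f_j\}$ is pointwise precompact on $T$, (b) $\{g_j\}$ is pointwise convergent on $T$ to a function $g\in M^T$, and $$\limsup_{j\to\infty}V_\kappa(f_j,g_j)<\infty.$$ Then there is a subsequence of $\{f_j\}$ which converges pointwise on $T=[a,b]$ to a function $f\in\mathrm{R}(g)$ such that $V_\kappa(f,g)<\infty$.
   Context: $M^T$ is the set of all functions $T\to M$. A sequence $\{f_j\}\subset M^T$ is pointwise precompact on $T$ if for every $t\in T$ the closure in $M$ of the set $\{f_j(t):j\in\mathbb{N}\}$ is compact. Pointwise convergence $f_j\to f$ on $T$ means $\lim_{j\to\infty}d(f_j(t),f(t))=0$ for all $t\in T$. For $f,g\in M^T$ and $s,t\in T$, the joint increment is $$|(f,g)(\{s,t\})|=\sup_{z\in M}\bigl|d(f(s),z)+d(g(t),z)-d(f(t),z)-d(g(s),z)\bigr|.$$ The joint $\kappa$-variation of $f,g\in M^{[a,b]}$ is $$V_\kappa(f,g)=\sup\left\{\frac{\sum_{i=1}^n|(f,g)(\{t_{i-1},t_i\})|}{\sum_{i=1}^n\kappa\bigl((t_i-t_{i-1})/(b-a)\bigr)}:\ n\in\mathbb{N},\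 a=t_0<t_1<\dots<t_{n-1}<t_n=b\right\}\in[0,\infty].$$ For $n\in\mathbb{N}=\{1,2,\dots\}$, $\{I_i\}_1^n\prec T$ denotes a collection of $n$ two-point subsets $I_i=\{s_i,t_i\}$ of $T$ with $s_1<t_1\le s_2<t_2\le\dots\le s_n<t_n$, and the joint modulus of variation of $f,g\in M^T$ is $$\nu_n(f,g)=\sup\Bigl\{\sum_{i=1}^n|(f,g)(I_i)|:\{I_i\}_1^n\prec T\Bigr\}\in[0,\infty],\quad n\in\mathbb{N}.$$ The regularity class of $g\in M^T$ is $\mathrm{R}(g)=\{f\in M^T:\nu_n(f,g)=o(n)\}$, where $\nu_n=o(n)$ means that all $\nu_n$ are finite and $\lim_{n\to\infty}\nu_n/n=0$. *)

(* Defs.v *)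
From HB Require Import structures.
From mathcomp Require Import all_boot all_order all_algebra.
From mathcomp Require Import all_classical all_reals all_analysis.

Set Implicit Arguments.
Unset Strict Implicit.
Unset Printing Implicit Defensive.

Import Order.TTheory GRing.Theory Num.Theory.
Import numFieldNormedType.Exports.

Local Open Scope classical_set_scope.
Local Open Scope ring_scope.

(* Elements of M^T, with T a subset of R, are represented by total functions
   R -> M of which only the values on T are ever used. *)

Section joint_variation.
Context {R : realType} {M : metricType R}.
Implicit Types (f g : R -> M) (T : set R) (s t a b : R).

Definition joint_incr f g s t : R :=
  sup [set `|mdist (f s) z + mdist (g t) z - mdist (f t) z - mdist (g s) z|
      | z in [set: M]].

(* [sup] is 0 by convention on sets without a supremum; this never occurs in
   [joint_incr]. *)
Lemma has_sup_joint_incr f g s t :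
  has_sup [set `|mdist (f s) z + mdist (g t) z - mdist (f t) z - mdist (g s) z|
          | z in [set: M]].
Proof.
split.
  by exists `|mdist (f s) (f s) + mdist (g t) (f s)
              - mdist (f t) (f s) - mdist (g s) (f s)|; exists (f s).
exists (mdist (f s) (f t) + mdist (g s) (g t)) => _ [z _ <-].
have := metric_triangle (f s) (f t) z; have := metric_triangle (f t) (f s) z.
have := metric_triangle (g s) (g t) z; have := metric_triangle (g t) (g s) z.
rewrite (metric_sym (f t) (f s)) (metric_sym (g t) (g s)) => h1 h2 h3 h4.
rewrite (_ : _ - _ - _ = (mdist (f s) z - mdist (f t) z)
                         + (mdist (g t) z - mdist (g s) z)); last first.
  by rewrite -!addrA; congr (_ + _); rewrite addrCA.
rewrite (le_trans (ler_normD _ _))// lerD// ler_norml.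
  by rewrite lerBlDr h4 andbT lerNl opprB lerBlDr h3.
by rewrite lerBlDr h1 andbT lerNl opprB lerBlDr h2.
Qed.

(* A partition a = t_0 < ... < t_n = b is encoded by s = [:: t_1; ...; t_n], so
   that n = size s and t_i = nth b (a :: s) i; n > 0 because a < b. *)
Definition joint_kappa_variation (kappa : R -> R) a b f g : \bar R :=
  ereal_sup [set
    (let t := nth b (a :: s) in
     (\sum_(0 <= i < size s) joint_incr f g (t i) (t i.+1)) /
     (\sum_(0 <= i < size s) kappa ((t i.+1 - t i) / (b - a))))%:E
    | s in [set s : seq R | itv_partition a b s]].

(* {I_i}_1^n < T with I_i = {(I i).1, (I i).2}, indexed by 0 <= i < n. *)
Definition ordered_pairs T (n : nat) (I : nat -> R * R) : Prop :=
  [/\ forall i, (i < n)%N -> T (I i).1 /\ T (I i).2,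
      forall i, (i < n)%N -> (I i).1 < (I i).2 &
      forall i, (i.+1 < n)%N -> (I i).2 <= (I i.+1).1].

(* Meant for infinite T only: the supremum over the empty set is -oo here. *)
Definition joint_modulus T (n : nat) f g : \bar R :=
  ereal_sup [set (\sum_(0 <= i < n) joint_incr f g (I i).1 (I i).2)%:E
            | I in [set I | ordered_pairs T n I]].

Definition regularity_class T g : set (R -> M) :=
  [set f | (forall n, (0 < n)%N -> joint_modulus T n f g \is a fin_num) /\
           (fine (joint_modulus T n f g) / n%:R @[n --> \oo] --> (0 : R))].

Definition pointwise_precompact_on T (F : nat -> R -> M) : Prop :=
  forall t, T t -> compact (closure (range (fun j => F j t))).

Definition pointwise_cvg_on T (F : nat -> R -> M) f : Prop :=
  forall t, T t -> mdist (F j t) (f t) @[j --> \oo] --> (0 : R).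

End joint_variation.

Definition concave_on {R : realType} (D : set R) (h : R -> R) : Prop :=
  @convex_function R R^o D (\- h).

(* Main.v *)
Require Import Defs.
From HB Require Import structures.
From mathcomp Require Import all_boot all_order all_algebra.
From mathcomp Require Import all_classical all_reals all_analysis.
From mathcomp Require Import ring lra.

(** The idea is to trade the bound on the joint kappa-variation for a bounded
    real function.  Write [c s t] for [C * kappa ((t - s) / (b - a))].  The
    inequality [V_kappa(f, g) <= C] says that over each partition of [[a, b]]
    the joint increments sum to at most the costs [c].  Hence the supremum [w t]
    of the sums of (increment - cost) over the partitions of [[a, t]] lies in
    [[-C, C]], and appending one point to a partition gives
      [joint_incr f g s t <= w t - w s + c s t]  for a <= s < t <= b.
    Such a [w] is called a potential ([potential_exists]).  Continuity of [kappa]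
    at 0 makes the cost almost linear: [c s t <= e + L * (t - s)] for every
    e > 0 and some L depending on e.

    A potential controls everything.  Summing the inequality over n ordered pairs
    telescopes, and yields [nu_n(f, g) <= 2 * C + 2 * n * e + L * (b - a)], which
    is o(n) ([potential_ordered_pairs], [kappa_variation_regular]).  Moreover
    increments are nonnegative, so [w] is nondecreasing up to small errors; it
    then behaves like a monotone function: outside a countable set its
    oscillation at a point vanishes ([quasi_nondecreasing_countable]).

    For the selection ([potential_selection]), let [w_ j] be the potential of the
    j-th pair.  Pointwise compactness provides limits [f] of [f_] and [w] of [w_]
    along an ultrafilter on the indices, and [w] is again a potential, for
    [(f, g)].  The points where [w] oscillates, the rationals and the two
    endpoints form a countable set [Q]; since only countably many conditions are
    at stake, one subsequence realizes the ultrafilter limits of [f_] and [w_] at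
    every point of [Q] ([countable_filter_subsequence]).  Convergence at the
    remaining points is forced: for [t] outside [Q], squeeze s < t < r with s, r
    in [Q] close to t.  Both [joint_incr (f_ j) (g_ j) s t] and
    [joint_incr f g s t] are bounded by the potential difference between [s] and
    [r], plus small costs, and that difference involves only points of [Q]; so
    both increments are eventually small, and since [f_ j s] tends to [f s],
    the distance from [f_ j t] to [f t] is small too.

    Finally the bound [V_kappa <= C] passes to the pointwise limit, because each
    sum of increments involves finitely many points, and membership of the limit
    in the regularity class follows from the existence of its own potential. *)

Set Implicit Arguments.
Unset Strict Implicit.
Unset Printing Implicit Defensive.

Import Order.TTheory GRing.Theory Num.Theory.
Import numFieldNormedType.Exports.

Local Open Scope classical_set_scope.
Local Open Scope ring_scope.

(** * Joint increments *)

Section joint_increment.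
Context {R : realType} {M : metricType R}.
Implicit Types (f g : R -> M) (s t : R).

Lemma ler_mdistB (x y z : M) : `|mdist x z - mdist y z| <= mdist x y.
Proof.
have := metric_triangle x y z; have := metric_triangle y x z.
by rewrite (metric_sym y x) ler_norml => h1 h2; apply/andP; split; lra.
Qed.

Lemma joint_incr_ge f g s t (z : M) :
  `|mdist (f s) z + mdist (g t) z - mdist (f t) z - mdist (g s) z|
  <= joint_incr f g s t.
Proof.
have [_ ub] := has_sup_joint_incr f g s t.
by apply: (ub_le_sup ub); exists z.
Qed.

Lemma joint_incr_le f g s t (c : R) :
  (forall z, `|mdist (f s) z + mdist (g t) z - mdist (f t) z - mdist (g s) z|
             <= c) ->
  joint_incr f g s t <= c.
Proof.
move=> fgc; apply: ge_sup; first by have [] := has_sup_joint_incr f g s t.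
by move=> _ [z _ <-].
Qed.

Lemma joint_incr_ge0 f g s t : 0 <= joint_incr f g s t.
Proof. exact: le_trans (joint_incr_ge f g s t (f s)). Qed.

Lemma joint_incr_perturb f g f' g' s t :
  joint_incr f g s t <= joint_incr f' g' s t +
    (mdist (f s) (f' s) + mdist (f t) (f' t) +
     (mdist (g s) (g' s) + mdist (g t) (g' t))).
Proof.
apply: joint_incr_le => z; have := joint_incr_ge f' g' s t z.
have := ler_mdistB (f s) (f' s) z; have := ler_mdistB (f t) (f' t) z.
have := ler_mdistB (g s) (g' s) z; have := ler_mdistB (g t) (g' t) z.
rewrite !ler_norml => /andP[? ?] /andP[? ?] /andP[? ?] /andP[? ?] /andP[? ?].
by apply/andP; split; lra.
Qed.

(** The increments of [(f, g)] and [(f', g')] transfer the closeness of [f] and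
    [f'] from [s] to [t]: taking the parameter z to be [f' t] isolates the
    distance [mdist (f t) (f' t)] in the difference of the two expressions. *)
Lemma mdist_joint_incr f g f' g' s t :
  mdist (f t) (f' t) <= joint_incr f g s t + joint_incr f' g' s t +
    mdist (f s) (f' s) + (mdist (g s) (g' s) + mdist (g t) (g' t)).
Proof.
have := joint_incr_ge f g s t (f' t); have := joint_incr_ge f' g' s t (f' t).
have := ler_mdistB (f s) (f' s) (f' t).
have := ler_mdistB (g s) (g' s) (f' t).
have := ler_mdistB (g t) (g' t) (f' t).
rewrite mdistxx !ler_norml.
by move=> /andP[? ?] /andP[? ?] /andP[? ?] /andP[? ?] /andP[? ?]; lra.
Qed.

Lemma joint_incr_cvg (F : set_system nat) (FF : ProperFilter F)
    (f_ g_ : nat -> R -> M) f g s t :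
  mdist (f_ j s) (f s) @[j --> F] --> (0 : R) ->
  mdist (f_ j t) (f t) @[j --> F] --> (0 : R) ->
  mdist (g_ j s) (g s) @[j --> F] --> (0 : R) ->
  mdist (g_ j t) (g t) @[j --> F] --> (0 : R) ->
  joint_incr (f_ j) (g_ j) s t @[j --> F] --> joint_incr f g s t.
Proof.
move=> fs ft gs gt.
pose r j : R := mdist (f_ j s) (f s) + mdist (f_ j t) (f t) +
            (mdist (g_ j s) (g s) + mdist (g_ j t) (g t)).
have r0 : r j @[j --> F] --> (0 : R).
  rewrite [X in _ --> X](_ : _ = 0 + 0 + (0 + 0)); last by rewrite !addr0.
  by apply: cvgD; exact: cvgD.
apply/subr_cvg0/norm_cvg0P.
apply: (squeeze_cvgr _ (cvg_cst 0) r0); apply: nearW => j.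
rewrite normr_ge0 /= ler_norml.
have := joint_incr_perturb f g (f_ j) (g_ j) s t.
have := joint_incr_perturb (f_ j) (g_ j) f g s t.
rewrite -/(r j) (metric_sym (f s)) (metric_sym (f t)) (metric_sym (g s)).
rewrite (metric_sym (g t)) -/(r j) => ? ?.
by apply/andP; split; lra.
Qed.

End joint_increment.

(** * Potentials *)

Section potential.
Context {R : realType}.
Implicit Types (a b : R) (J c : R -> R -> R) (w : R -> R).

(** [J] is an increment to be controlled and [c] a cost allowed for each pair of
    points; telescoping makes the [w]-part of a sum over consecutive points
    independent of their number. *)
Definition potential a b J c w : Prop :=
  forall s t, a <= s -> s < t -> t <= b -> J s t <= w t - w s + c s t.

(** The potential at [t] is the largest excess of increments over costs along a
    partition of [[a, t]].  It is bounded above since such a partition extends,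
    at a cost of at most [C], to one of [[a, b]], whose excess is nonpositive. *)
Lemma potential_exists a b J c (C : R) : 0 <= C ->
  (forall s t, 0 <= J s t) ->
  (forall s t, a <= s -> s < t -> t <= b -> 0 <= c s t <= C) ->
  (forall p, itv_partition a b p -> let x := nth b (a :: p) in
    \sum_(0 <= i < size p) J (x i) (x i.+1) <=
    \sum_(0 <= i < size p) c (x i) (x i.+1)) ->
  exists2 w, potential a b J c w & forall t, a <= t <= b -> `|w t| <= C.
Proof.
move=> C0 J0 c0C Jc.
pose S p := \sum_(0 <= i < size p)
  (J (nth b (a :: p) i) (nth b (a :: p) i.+1) -
   c (nth b (a :: p) i) (nth b (a :: p) i.+1)).
pose W t := [set S p | p in [set p | itv_partition a t p]].
have S_rcons p s t : itv_partition a s p ->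
    S (rcons p t) = S p + (J s t - c s t).
  move=> ps; rewrite /S size_rcons big_nat_recr//=; congr (_ + _).
    rewrite !big_nat; apply: eq_bigr => i /= ip.
    by rewrite -rcons_cons !nth_rcons/= !ltnS (ltnW ip) ip.
  rewrite -rcons_cons !nth_rcons/= ltnS leqnn ltnn eqxx.
  by rewrite (itv_partition_nth_size _ ps).
have part_rcons p s t : itv_partition a s p -> s < t ->
    itv_partition a t (rcons p t).
  move=> ps st; rewrite -cats1; apply: itv_partition_cat ps _.
  exact: itv_partition1.
have S_le p t : t <= b -> itv_partition a t p -> S p <= C.
  have S_le0 q : itv_partition a b q -> S q <= 0.
    by move=> /Jc/=; rewrite /S sumrB subr_le0.
  rewrite le_eqVlt => /predU1P[->|tb] pt; first exact: le_trans (S_le0 _ pt) C0.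
  have := S_le0 _ (part_rcons _ _ _ pt tb); rewrite (S_rcons _ _ _ pt).
  have := c0C t b (itv_partition_le pt) tb (lexx b); have := J0 t b.
  by move=> ? /andP[_ ?]; lra.
have Wn0 t : a <= t -> W t !=set0.
  rewrite le_eqVlt => /predU1P[<-|at_]; first by exists (S [::]); exists [::].
  by exists (S [:: t]); exists [:: t] => //; exact: itv_partition1.
have Wub t : t <= b -> has_ubound (W t).
  by move=> tb; exists C => _ [p pt <-]; exact: S_le pt.
exists (fun t => sup (W t)).
  move=> s t as_ st tb.
  suff : sup (W s) <= sup (W t) - (J s t - c s t) by move=> ?; lra.
  apply: ge_sup; first exact: Wn0.
  move=> _ [p ps <-]; rewrite lerBrDr -S_rcons//.
  apply: (ub_le_sup (Wub _ tb)).
  by exists (rcons p t) => //; exact: part_rcons st.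
move=> t /andP[at_ tb]; rewrite ler_norml; apply/andP; split; last first.
  by apply: ge_sup; [exact: Wn0|move=> _ [p pt <-]; exact: S_le pt].
(* The only partition of [a, a] is the empty one. *)
move: (at_); rewrite le_eqVlt => /predU1P[a_t|{}at_].
  apply: (@le_trans _ _ 0); first by rewrite oppr_le0.
  apply: (ub_le_sup (Wub _ tb)); exists [::]; last by rewrite /S big_nil.
  by rewrite a_t.
apply: (@le_trans _ _ (S [:: t])).
  rewrite /S big_nat1/=; have := J0 a t.
  by have /andP[] := c0C a t (lexx a) at_ tb; lra.
apply: (ub_le_sup (Wub _ tb)); exists [:: t] => //; exact: itv_partition1.
Qed.

(** The potential differences telescope: the gaps between consecutive pairs also
    satisfy the potential inequality, with a nonnegative increment, and so
    contribute nothing but their cost.  The 2n intervals, pairs and gaps, cost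
    [e] each, and their lengths add up to at most [b - a]. *)
Lemma potential_ordered_pairs a b J c w (B e L : R) n (I : nat -> R * R) :
  (forall s t, 0 <= J s t) -> 0 <= e -> 0 <= L ->
  potential a b J c w -> (forall t, a <= t <= b -> `|w t| <= B) ->
  (forall s t, a <= s -> s < t -> t <= b -> c s t <= e + L * (t - s)) ->
  ordered_pairs `[a, b] n.+1 I ->
  \sum_(0 <= i < n.+1) J (I i).1 (I i).2 <=
  2 * B + (n.+1).*2%:R * e + L * (b - a).
Proof.
move=> J0 e0 L0 Jw wB cL [Iab I12 II].
have Iab1 i : (i < n.+1)%N -> a <= (I i).1 <= b /\ a <= (I i).2 <= b.
  by move=> /Iab; rewrite /= !in_itv.
have wL s t : a <= s -> s <= t -> t <= b -> w s <= w t + e + L * (t - s).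
  move=> as_; rewrite le_eqVlt => /predU1P[<- _|st tb].
    by rewrite subrr mulr0 addr0 lerDl.
  by have := Jw s t as_ st tb; have := cL s t as_ st tb; have := J0 s t; lra.
have : forall m, (m <= n)%N -> \sum_(0 <= i < m.+1) J (I i).1 (I i).2 <=
    w (I m).2 - w (I 0%N).1 + (m.+1).*2%:R * e + L * ((I m).2 - (I 0%N).1).
  elim=> [|m ih] mn.
    rewrite big_nat1; have [/andP[h1 _] /andP[_ h2]] := Iab1 0%N (ltn0Sn n).
    have lt12 := I12 _ (ltn0Sn n).
    have := Jw _ _ h1 lt12 h2; have := cL _ _ h1 lt12 h2.
    by rewrite -[(1.*2)%:R]/(2 : R); lra.
  have mn' : (m.+1 < n.+1)%N by [].
  rewrite big_nat_recr//=.
  have [/andP[h1 h1'] /andP[_ h2]] := Iab1 _ mn'.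
  have [_ /andP[h3 _]] := Iab1 _ (ltnW mn').
  have := Jw _ _ h1 (I12 _ mn') h2; have := cL _ _ h1 (I12 _ mn') h2.
  have := wL _ _ h3 (II _ mn') h1'; have := ih (ltnW mn).
  rewrite [(m.+2).*2]doubleS -[((m.+1).*2).+2]addn2 natrD; lra.
move=> /(_ n (leqnn n)) /le_trans; apply.
have [h1 _] := Iab1 0%N (ltn0Sn n); have [_ h2] := Iab1 n (leqnn n.+1).
have := wB _ h1; have := wB _ h2; rewrite !ler_norml.
move=> /andP[_ ?] /andP[? _].
have : L * ((I n).2 - (I 0%N).1) <= L * (b - a).
  by apply: ler_wpM2l => //; move: h1 h2 => /andP[? _] /andP[_ ?]; lra.
lra.
Qed.

End potential.

(** * Oscillation of almost monotone functions *)

Section quasi_monotone.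
Context {R : realType}.
Implicit Types (a b : R) (w : R -> R).

(** Monotonicity up to an arbitrarily small error [e], after adding a linear
    function whose slope may blow up as [e] tends to 0. *)
Definition quasi_nondecreasing a b w : Prop :=
  forall e, 0 < e -> exists2 L, 0 <= L &
    forall s t, a <= s -> s <= t -> t <= b -> w s <= w t + e + L * (t - s).

(** The one-sided limits of a monotone function exist; where they agree, the
    values on both sides of the point are close to their common value. *)
Lemma nondecreasing_small_oscillation a b (F : R -> R) t (e : R) :
  {in `[a, b] &, nondecreasing_fun F} -> a < t -> t < b ->
  ~ discontinuity F t -> 0 < e ->
  exists2 d, 0 < d & forall s r, t - d < s -> s < t -> t < r -> r < t + d ->
    F r - F s <= e.
Proof.
move=> Fnd at_ tb Ft e0.
have e20 : 0 < e / 2 by rewrite divr_gt0.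
have cl : cvg (F x @[x --> t^'-]).
  apply: nondecreasing_at_left_is_cvgr; near=> x.
    move=> y z; rewrite !in_itv/= => /andP[xy yt] /andP[xz zt]; apply: Fnd;
      rewrite in_itv/=; apply/andP; split.
    - by apply/ltW/(lt_trans _ xy); near: x; exact: nbhs_left_gt.
    - exact/ltW/(lt_trans yt).
    - by apply/ltW/(lt_trans _ xz); near: x; exact: nbhs_left_gt.
    - exact/ltW/(lt_trans zt).
  exists (F t) => _ [y /= + <-]; rewrite in_itv/= => /andP[xy yt].
  apply: Fnd; last 2 first.
  - by rewrite in_itv/= (ltW at_) (ltW tb).
  - exact: ltW.
  rewrite in_itv/= (ltW (lt_trans yt tb)) andbT.
  by apply/ltW/(lt_trans _ xy); near: x; exact: nbhs_left_gt.
have cr : cvg (F x @[x --> t^'+]).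
  apply: nondecreasing_at_right_is_cvgr; near=> x.
    move=> y z; rewrite !in_itv/= => /andP[ty yx] /andP[tz zx]; apply: Fnd;
      rewrite in_itv/=; apply/andP; split.
    - exact/ltW/(lt_trans _ ty).
    - by apply/ltW/(lt_trans yx); near: x; exact: nbhs_right_lt.
    - exact/ltW/(lt_trans _ tz).
    - by apply/ltW/(lt_trans zx); near: x; exact: nbhs_right_lt.
  exists (F t) => _ [y /= + <-]; rewrite in_itv/= => /andP[ty yx].
  apply: Fnd; first by rewrite in_itv/= (ltW at_) (ltW tb).
    rewrite in_itv/= (ltW (lt_trans at_ ty))/=.
    by apply/ltW/(lt_trans yx); near: x; exact: nbhs_right_lt.
  exact: ltW.
have lr : lim (F x @[x --> t^'-]) = lim (F x @[x --> t^'+]).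
  by apply: contrapT => /eqP lr; apply: Ft.
have /cvgrPdist_lt/(_ _ e20)[d1 /= d10 Fl] := cl.
have /cvgrPdist_lt/(_ _ e20)[d2 /= d20 Fr] := cr.
exists (Num.min d1 d2) => [|s r]; first by rewrite lt_min d10.
rewrite ltrBlDr -ltrBlDl lt_min => /andP[sd _] st tr.
rewrite -ltrBlDl lt_min => /andP[_ rd].
have := Fl s; rewrite /ball/= gtr0_norm ?subr_gt0// => /(_ sd st).
have := Fr r; rewrite /ball/= distrC gtr0_norm ?subr_gt0// => /(_ rd tr).
rewrite lr !ltr_norml => /andP[? ?] /andP[? ?]; lra.
Unshelve. all: end_near. Qed.

(** For every error 1/(m+1), the running supremum [F m] of [w s + L m * s] is
    nondecreasing, and within 1/(m+1) of that function.  Away from the countably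
    many jumps of all the [F m], the function [w] inherits their small
    oscillation; the linear term is harmless because its slope is nonnegative. *)
Lemma quasi_nondecreasing_countable a b w (B : R) :
  (forall t, a <= t <= b -> `|w t| <= B) -> quasi_nondecreasing a b w ->
  exists2 E, countable E & forall t, a < t -> t < b -> ~ E t ->
    forall e, 0 < e -> exists2 d, 0 < d &
      forall s r, a <= s -> r <= b -> t - d < s -> s < t -> t < r -> r < t + d ->
        w r - w s <= e.
Proof.
move=> wB wqn.
have /choice[L LP] (m : nat) : exists L, 0 <= L /\
    forall s t, a <= s -> s <= t -> t <= b ->
      w s <= w t + m.+1%:R^-1 + L * (t - s).
  by have [//|L L0 LP] := wqn m.+1%:R^-1; exists L.
pose W m t := [set w s + L m * s | s in `[a, t]].
pose F m t := sup (W m t).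
have Wub m t : t <= b -> has_ubound (W m t).
  move=> tb; exists (B + L m * b) => _ [s /= + <-].
  rewrite in_itv/= => /andP[as_ st]; have sb := le_trans st tb.
  have [L0 _] := LP m; apply: lerD; last exact: ler_wpM2l.
  by apply: le_trans (wB s _); rewrite ?ler_norm ?as_.
have F_ge m t : a <= t -> t <= b -> w t + L m * t <= F m t.
  move=> at_ tb; apply: (ub_le_sup (Wub m t tb)).
  by exists t; rewrite //= in_itv/= at_ lexx.
have F_le m t : a <= t -> t <= b -> F m t <= w t + L m * t + m.+1%:R^-1.
  move=> at_ tb; apply: ge_sup.
    by exists (w t + L m * t), t; rewrite //= in_itv/= at_ lexx.
  move=> _ [s /= + <-]; rewrite in_itv/= => /andP[as_ st].
  have [_ /(_ s t as_ st tb)] := LP m; move: m.+1%:R^-1 => x; lra.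
have Fnd m : {in `[a, b] &, nondecreasing_fun (F m)}.
  move=> x y; rewrite !in_itv/= => /andP[ax xb] /andP[ay yb] xy.
  apply: ge_sup.
    by exists (w x + L m * x), x; rewrite //= in_itv/= ax lexx.
  move=> _ [s /= + <-]; rewrite in_itv/= => /andP[as_ sx].
  apply: (ub_le_sup (Wub m y yb)); exists s => //.
  by rewrite /= in_itv/= as_ (le_trans sx).
exists (\bigcup_m [set x | x \in (`]a, b[) /\ discontinuity (F m) x]).
  by apply: bigcup_countable => // m _; exact: discontinuity_countable.
move=> t at_ tb Et e e0.
have e20 : 0 < e / 2 by rewrite divr_gt0.
have [m me] : exists m : nat, m.+1%:R^-1 < e / 2.
  near \oo => m; exists m; near: m.
  exact: near_infty_natSinv_lt (PosNum e20).
have [|d d0 dP] := nondecreasing_small_oscillation (Fnd m) at_ tb _ e20.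
  by move=> Ft; apply: Et; exists m => //; split; rewrite // in_itv/= at_.
exists d => // s r as_ rb tds st tr rtd.
have sr := ltW (lt_trans st tr).
have := dP s r tds st tr rtd; have := F_ge m r (le_trans as_ sr) rb.
have := F_le m s as_ (le_trans sr rb).
have [L0 _] := LP m; have : 0 <= L m * (r - s) by rewrite mulr_ge0 ?subr_ge0.
move: m.+1%:R^-1 me => x; lra.
Unshelve. all: end_near. Qed.

End quasi_monotone.

(** * Limits along an ultrafilter and subsequences *)

Section ultrafilter_limits.

Lemma increasing_seq_ge (sigma : nat -> nat) k :
  increasing_seq sigma -> (k <= sigma k)%N.
Proof.
move=> /increasing_seqP sigmaS; elim: k => // k ih.
exact: leq_ltn_trans ih (sigmaS k).
Qed.

Lemma increasing_seq_cvg (sigma : nat -> nat) :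
  increasing_seq sigma -> sigma k @[k --> \oo] --> \oo.
Proof.
move=> sigma_incr A [N _ NA]; exists N => // k /= Nk.
by apply: NA; exact: leq_trans Nk (increasing_seq_ge k sigma_incr).
Qed.

Lemma pointwise_cvg_on_comp (R : realType) (M : metricType R) (T : set R)
    (F : nat -> R -> M) (f : R -> M) (sigma : nat -> nat) :
  sigma k @[k --> \oo] --> \oo ->
  pointwise_cvg_on T F f -> pointwise_cvg_on T (F \o sigma) f.
Proof. by move=> sigmaoo Ff t Tt; exact: cvg_comp sigmaoo (Ff t Tt). Qed.

Lemma ultra_fmap (T T' : Type) (u : T -> T') (U : set_system T) :
  UltraFilter U -> UltraFilter (u x @[x --> U]).
Proof.
move=> UU; split=> [|G GF UG]; first exact: fmap_proper_filter.
rewrite eqEsubset; split=> // A GA.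
have [//|UnA] := in_ultra_setVsetC (u @^-1` A) UU.
have GnA : G (~` A) by apply: UG.
by have [x []] := filter_ex (filterI GA GnA).
Qed.

Lemma ultra_compact_cvg (I : Type) (T : topologicalType) (K : set T)
    (u : I -> T) (U : set_system I) :
  UltraFilter U -> compact K -> (forall i, K (u i)) ->
  exists l : T, u i @[i --> U] --> l.
Proof.
move=> UU; rewrite compact_ultra => /= Kc Ku.
have UuU := ultra_fmap u UU.
have [|l [_ ul]] := Kc _ UuU; last by exists l.
by apply: (@filterS _ U _ setT) => [i _|]; [exact: Ku|exact: filterT].
Qed.

Lemma cvg_mdist (R : realType) (M : metricType R) (I : Type)
    (F : set_system I) (FF : Filter F) (u : I -> M) l :
  u i @[i --> F] --> l -> mdist (u i) l @[i --> F] --> (0 : R).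
Proof.
move=> ul; apply/cvgrPdist_lt => e e0.
have Fb : F [set i | ball l e (u i)] by apply: ul; exact: (nbhsx_ballx l e e0).
apply: (@filterS _ F _ _ _ _ Fb) => i /=.
rewrite ballEmdist/= sub0r normrN metric_sym.
by rewrite ger0_norm ?mdist_ge0.
Qed.

(** A diagonal argument: finitely many members of a filter finer than [\oo] meet
    in an infinite set, so [sigma k] can be chosen beyond [sigma k.-1] in the
    first [k.+1] members of an enumeration.  This turns convergence along an
    ultrafilter, at countably many points, into convergence of a subsequence. *)
Lemma countable_filter_subsequence (T : Type) (Q : set T) (U : set_system nat)
    (UU : ProperFilter U) (P : T -> set nat) :
  \oo `<=` U -> countable Q -> (forall x, Q x -> U (P x)) ->
  exists2 sigma, increasing_seq sigma &
    forall x, Q x -> \forall k \near \oo, P x (sigma k).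
Proof.
move=> ooU /countable_injP[phi phi_inj] QP.
pose P' n := [set j | forall x, Q x -> phi x = n -> P x j].
have UP' n : U (P' n).
  have [[x [Qx xn]]|nex] := pselect (exists x, Q x /\ phi x = n).
    apply: filterS (QP x Qx) => j Pj y Qy yn.
    suff -> : y = x by [].
    by apply: phi_inj; rewrite ?inE// yn.
  apply: (@filterS _ U _ setT); last exact: filterT.
  by move=> j _ x Qx xn; case: nex; exists x.
have UP'' k : U [set j | forall n, (n <= k)%N -> P' n j].
  elim: k => [|k ih].
    by apply: filterS (UP' 0%N) => j ? n; rewrite leqn0 => /eqP ->.
  apply: filterS (filterI ih (UP' k.+1)) => j /= [h1 h2] n.
  by rewrite leq_eqVlt => /predU1P[->//|]; rewrite ltnS; exact: h1.
have /choice[h hP] (p : nat * nat) :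
    exists j, (p.2 < j)%N /\ forall n, (n <= p.1)%N -> P' n j.
  have [j [? ?]] := filter_ex (filterI (ooU _ (nbhs_infty_gt p.2)) (UP'' p.1)).
  by exists j.
pose sigma := fix F k := if k is k'.+1 then h (k, F k') else h (0%N, 0%N).
exists sigma.
  by apply/increasing_seqP => k; have [] := hP (k.+1, sigma k).
move=> x Qx; exists (phi x) => // k /= xk.
suff : forall n, (n <= k)%N -> P' n (sigma k) by move=> /(_ _ xk x Qx erefl).
case: k {xk} => [|k]; first by have [] := hP (0%N, 0%N).
by have [] := hP (k.+1, sigma k).
Qed.

End ultrafilter_limits.

(** * Selection of a pointwise convergent subsequence *)

Section selection.
Context {R : realType} {M : metricType R}.
Implicit Types (f g : R -> M) (c : R -> R -> R).

Lemma countableU (T : Type) (A B : set T) :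
  countable A -> countable B -> countable (A `|` B).
Proof.
move=> cA cB.
have -> : A `|` B = \bigcup_(i in [set: bool]) (if i then A else B).
  apply/seteqP; split=> [x [Ax|Bx]|x [[] _ /= ?]]; first by exists true.
  - by exists false.
  - by left.
  - by right.
by apply: bigcup_countable => // -[].
Qed.

(** Such a cost is small on short intervals, and its sums over disjoint intervals
    grow sublinearly in the number of intervals. *)
Definition almost_linear_cost (a b : R) c : Prop :=
  forall e, 0 < e -> exists2 L, 0 <= L &
    forall s t, a <= s -> s < t -> t <= b -> c s t <= e + L * (t - s).

Lemma potential_limit (F : set_system nat) (FF : ProperFilter F) (a b : R)
    (f_ g_ : nat -> R -> M) f g c (w_ : nat -> R -> R) (w : R -> R) :
  (forall t, a <= t <= b -> mdist (f_ j t) (f t) @[j --> F] --> (0 : R)) ->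
  (forall t, a <= t <= b -> mdist (g_ j t) (g t) @[j --> F] --> (0 : R)) ->
  (forall t, a <= t <= b -> w_ j t @[j --> F] --> w t) ->
  (forall j, potential a b (joint_incr (f_ j) (g_ j)) c (w_ j)) ->
  potential a b (joint_incr f g) c w.
Proof.
move=> fF gF wF wP s t as_ st tb.
have sab : a <= s <= b by rewrite as_ (le_trans (ltW st)).
have tab : a <= t <= b by rewrite tb (le_trans as_ (ltW st)).
have Jcvg := joint_incr_cvg FF (fF _ sab) (fF _ tab) (gF _ sab) (gF _ tab).
have wcvg : w_ j t - w_ j s + c s t @[j --> F] --> w t - w s + c s t.
  by apply: cvgD; [apply: cvgB; exact: wF|exact: cvg_cst].
by apply: (ler_cvg_to Jcvg wcvg); apply: nearW => j; exact: wP.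
Qed.

(** An ultrafilter yields limits at all points at once, a subsequence only at the
    countably many points of [Q].  At the other points [w_ j t] itself is not
    controlled, but the potential inequality on [[t, r]] bounds it by
    [w_ j r + c t r]; so the increment between [s] and [t] is bounded by the
    values of the potentials at [s] and [r], where they converge. *)
Lemma potential_selection (a b : R) (f_ g_ : nat -> R -> M) g c
    (w_ : nat -> R -> R) (B : R) :
  pointwise_precompact_on `[a, b] f_ -> pointwise_cvg_on `[a, b] g_ g ->
  almost_linear_cost a b c ->
  (forall j, potential a b (joint_incr (f_ j) (g_ j)) c (w_ j)) ->
  (forall j t, a <= t <= b -> `|w_ j t| <= B) ->
  exists sigma f, increasing_seq sigma /\
    pointwise_cvg_on `[a, b] (f_ \o sigma) f.
Proof.
move=> fK gcvg cL wP wB.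
have [U [UU ooU]] := ultraFilterLemma eventually_filter.
have PU : ProperFilter U by exact: ultra_proper.
have /choice[f fU] t : exists l, a <= t <= b ->
    mdist (f_ j t) l @[j --> U] --> (0 : R).
  have [tab|] := pselect (a <= t <= b); last by exists (f_ 0%N t).
  have Kt : compact (closure (range (f_ ^~ t))).
    by apply: fK; rewrite /= in_itv.
  have [|l ftl] := ultra_compact_cvg UU Kt (u := f_ ^~ t).
    by move=> j; apply: subset_closure; exists j.
  by exists l => _; exact: cvg_mdist.
have /choice[w wU] t : exists l, a <= t <= b ->
    w_ j t @[j --> U] --> (l : R).
  have [tab|] := pselect (a <= t <= b); last by exists 0.
  have [|l wtl] := ultra_compact_cvg UU (@segment_compact _ (- B) B)
      (u := w_ ^~ t).
    by move=> j; rewrite /= in_itv/= -ler_norml; exact: wB.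
  by exists l.
have gU t : a <= t <= b -> mdist (g_ j t) (g t) @[j --> U] --> (0 : R).
  move=> tab; have gt : mdist (g_ j t) (g t) @[j --> \oo] --> (0 : R).
    by apply: gcvg; rewrite /= in_itv.
  by apply: cvg_trans gt => A; exact: ooU.
have fgP := potential_limit PU fU gU wU wP.
have wlB t : a <= t <= b -> `|w t| <= B.
  move=> tab.
  have wtU : `|w_ j t| @[j --> U] --> `|w t| by apply: cvg_norm; exact: wU.
  have Bcvg : B @[j --> U] --> B by exact: cvg_cst.
  by apply: (ler_cvg_to wtU Bcvg); apply: nearW => j; exact: wB.
have wqnd : quasi_nondecreasing a b w.
  move=> e e0; have [L L0 cLe] := cL e e0; exists L => // s t as_.
  rewrite le_eqVlt => /predU1P[<- _|st tb].
    by rewrite subrr mulr0 addr0 lerDl ltW.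
  have := fgP s t as_ st tb; have := cLe s t as_ st tb.
  by have := joint_incr_ge0 f g s t; lra.
have [E Ecount EP] := quasi_nondecreasing_countable wlB wqnd.
pose Q := E `|` [set a] `|` [set b] `|` range (@ratr R).
have Qcount : countable Q.
  apply: countableU.
    apply: countableU; last exact: countable1.
    by apply: countableU => //; exact: countable1.
  by apply: sub_countable (card_image_le _ _) _.
(* The precision of the approximation is part of the countable index, so that
   eventual membership in all the [P (t, m)] means convergence at [t]. *)
pose P (x : R * nat) := [set j | a <= x.1 <= b ->
  mdist (f_ j x.1) (f x.1) < x.2.+1%:R^-1 /\
  `|w x.1 - w_ j x.1| < x.2.+1%:R^-1].
have [[t m] _|sigma sigma_incr sigmaP] :=
    countable_filter_subsequence PU (P := P) ooU
      (countableX Qcount (@countableP nat setT)).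
- have [tab|ntab] := pselect (a <= t <= b); last first.
    by apply: (@filterS _ U _ setT) => [j _ /=|]; [|exact: filterT].
  have m0 : 0 < m.+1%:R^-1 :> R by [].
  have /cvgrPdist_lt/(_ _ m0) ftm := fU t tab.
  have /cvgrPdist_lt/(_ _ m0) wtm := wU t tab.
  apply: (@filterS _ U _ _ _ _ (filterI ftm wtm)) => j /= [].
  by rewrite sub0r normrN ger0_norm ?mdist_ge0.
have Qlim t e : a <= t <= b -> Q t -> 0 < e -> \forall k \near \oo,
    mdist (f_ (sigma k) t) (f t) < e /\ `|w t - w_ (sigma k) t| < e.
  move=> tab Qt e0.
  have [m me] : exists m : nat, m.+1%:R^-1 < e.
    near \oo => m; exists m; near: m.
    exact: near_infty_natSinv_lt (PosNum e0).
  have := sigmaP (t, m) (conj Qt I); apply: filterS => k /= /(_ tab)[h1 h2].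
  by split; [exact: lt_trans me|exact: lt_trans me].
have sigmaoo := increasing_seq_cvg sigma_incr.
exists sigma, f; split => // t; rewrite /= in_itv/= => tab.
apply/cvgrPdist_le => e0 e00.
have [Qt|Qt] := pselect (Q t).
  apply: filterS (Qlim t e0 tab Qt e00) => k [/ltW + _].
  by rewrite sub0r normrN ger0_norm ?mdist_ge0.
have at_ : a < t.
  rewrite lt_neqAle; case/andP: tab => -> _; rewrite andbT; apply/eqP => ta.
  by apply: Qt; left; left; right.
have tb : t < b.
  rewrite lt_neqAle; case/andP: tab => _ ->; rewrite andbT; apply/eqP => tb.
  by apply: Qt; left; right.
have Et : ~ E t by move=> Et; apply: Qt; left; left; left.
(* [5 * e] bounds the limit increment, [7 * e] that of the subsequence, and
   three more distances are below [e]. *)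
pose e := e0 / 15; have e_gt0 : 0 < e by rewrite divr_gt0.
have [d d0 dP] := EP t at_ tb Et e e_gt0.
have [L L0 Le] := cL e e_gt0.
pose d' := Num.min d (e / (L + 1)).
have d'0 : 0 < d' by rewrite lt_min d0 divr_gt0// ltr_wpDl.
have c_le s r : a <= s -> s < r -> r <= b -> r - s <= d' -> c s r <= e + e.
  move=> as_ sr rb rs; apply: le_trans (Le s r as_ sr rb) _.
  rewrite lerD2l; apply: (@le_trans _ _ ((L + 1) * (e / (L + 1)))); last first.
    by rewrite mulrC divfK// gt_eqF// ltr_wpDl.
  apply: ler_pM => //; first by rewrite subr_ge0 ltW.
    by rewrite lerDl.
  by move: rs; rewrite le_min => /andP[].
have [q1] : exists q : rat, ratr q \in `](Num.max a (t - d')), t[.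
  by apply: rat_in_itvoo; rewrite gt_max at_ ltrBlDr ltrDl.
have [q2] : exists q : rat, ratr q \in `]t, (Num.min b (t + d'))[.
  by apply: rat_in_itvoo; rewrite lt_min tb ltrDl.
have Qq q : Q (ratr q) by right; exists q.
(* Both endpoints of the short interval [s, r] around [t] belong to [Q]. *)
move: (Qq q1) (Qq q2); move: (ratr q1) (ratr q2) => s r Qs Qr {Qq}.
rewrite !in_itv/= lt_min gt_max.
move=> /andP[tr /andP[rb rd]] /andP[/andP[as_ sd] st].
have d'd : d' <= d by rewrite ge_min lexx.
have wrs : w r - w s <= e.
  by apply: dP => //; [exact: ltW|exact: ltW|lra|lra].
have sab : a <= s <= b by rewrite (ltW as_) (ltW (lt_trans st tb)).
have rab : a <= r <= b by rewrite (ltW rb) (ltW (lt_trans at_ tr)).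
have cst : c s t <= e + e by apply: c_le => //; [exact: ltW|exact: ltW|lra].
have ctr : c t r <= e + e by apply: c_le => //; [exact: ltW|exact: ltW|lra].
have Jlim : joint_incr f g s t <= 5 * e.
  have := fgP s t (ltW as_) st (ltW tb); have := fgP t r (ltW at_) tr (ltW rb).
  by have := joint_incr_ge0 f g t r; lra.
have gnear x : a <= x <= b -> \forall k \near \oo,
    mdist (g_ (sigma k) x) (g x) < e.
  move=> xab; have gx : mdist (g_ (sigma j) x) (g x) @[j --> \oo] --> (0 : R).
    by apply: (pointwise_cvg_on_comp sigmaoo gcvg); rewrite /= in_itv.
  have /cvgrPdist_lt/(_ _ e_gt0) := gx; apply: filterS => k.
  by rewrite sub0r normrN ger0_norm ?mdist_ge0.
near=> k; rewrite sub0r normrN ger0_norm ?mdist_ge0//=.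
have gs : mdist (g_ (sigma k) s) (g s) < e by near: k; exact: gnear.
have gt : mdist (g_ (sigma k) t) (g t) < e by near: k; exact: gnear.
have [fs ws] : mdist (f_ (sigma k) s) (f s) < e /\
  `|w s - w_ (sigma k) s| < e by near: k; exact: Qlim.
have [_ wr] : mdist (f_ (sigma k) r) (f r) < e /\
  `|w r - w_ (sigma k) r| < e by near: k; exact: Qlim.
have Jk : joint_incr (f_ (sigma k)) (g_ (sigma k)) s t <= 7 * e.
  have := wP (sigma k) s t (ltW as_) st (ltW tb).
  have := wP (sigma k) t r (ltW at_) tr (ltW rb).
  have := joint_incr_ge0 (f_ (sigma k)) (g_ (sigma k)) t r.
  move: ws wr; rewrite !ltr_norml => /andP[? ?] /andP[? ?]; lra.
have := mdist_joint_incr (f_ (sigma k)) (g_ (sigma k)) f g s t.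
have -> : e0 = 15 * e by rewrite /e mulrC divfK.
lra.
Unshelve. all: end_near. Qed.

End selection.

(** * Joint kappa-variation *)

Section kappa_variation.
Context {R : realType} {M : metricType R}.
Variables (a b : R) (kappa : R -> R).
Hypotheses (ab : a < b)
  (kappa01 : forall x, x \in `[0, 1] -> kappa x \in `[0, 1])
  (kappa_cont : {within `[0, 1], continuous kappa})
  (kappa_incr : {in `[0, 1] &, increasing_fun kappa})
  (kappa0 : kappa 0 = 0).
Implicit Types (f g : R -> M) (s t : R).

Let unit_length s t : a <= s -> s <= t -> t <= b ->
  (t - s) / (b - a) \in `[0, 1].
Proof.
move=> as_ st tb; rewrite in_itv/= divr_ge0 ?subr_ge0 ?(ltW ab)//=.
by rewrite ler_pdivrMr ?subr_gt0// mul1r lerB.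
Qed.

Let kappa_length_gt0 s t : a <= s -> s < t -> t <= b ->
  0 < kappa ((t - s) / (b - a)).
Proof.
move=> as_ st tb; have st01 := unit_length as_ (ltW st) tb.
rewrite -kappa0 ltNge kappa_incr//; last by rewrite in_itv/= lexx ler01.
by rewrite -ltNge divr_gt0 ?subr_gt0.
Qed.

(** Near 0, [kappa] is small by continuity; at distance at least [d] from 0 it is
    at most [1 <= x / d]. *)
Lemma kappa_almost_linear (C : R) : 0 <= C ->
  almost_linear_cost a b (fun s t => C * kappa ((t - s) / (b - a))).
Proof.
move=> C0 e e0; pose e' := e / (C + 1).
have C1 : 0 < C + 1 by rewrite ltr_wpDl.
have e'0 : 0 < e' by rewrite divr_gt0.
have [_ kr _] := (continuous_within_itvP kappa ltr01).1 kappa_cont.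
have /cvgrPdist_lt/(_ _ e'0)[d /= d0 kd] := kr.
exists (C / d / (b - a)); first by rewrite !divr_ge0// ?subr_ge0 ltW.
move=> s t as_ st tb; set x := (t - s) / (b - a).
have x01 : x \in `[0, 1] by exact: unit_length (ltW st) tb.
have x0 : 0 < x by rewrite divr_gt0 ?subr_gt0.
have -> : C / d / (b - a) * (t - s) = C * (x / d).
  by rewrite /x; ring.
have kx1 : kappa x <= 1 by have := kappa01 x01; rewrite in_itv/= => /andP[].
have [xd|dx] := ltP x d.
  have := kd x; rewrite /ball/= sub0r normrN gtr0_norm// kappa0 sub0r normrN.
  move=> /(_ xd x0) /(le_lt_trans (ler_norm _))/ltW kxe.
  rewrite -[leLHS]addr0; apply: lerD.
    apply: le_trans (ler_wpM2l C0 kxe) _.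
    by rewrite /e' mulrCA ger_pMr// ler_pdivrMr// mul1r lerDl.
  by rewrite mulr_ge0// divr_ge0// ltW.
rewrite -[leLHS]add0r; apply: lerD; first exact: ltW.
apply: ler_wpM2l => //; apply: le_trans kx1 _.
by rewrite ler_pdivlMr// mul1r.
Qed.

(** Clears the denominators, which are positive since [kappa] is increasing and
    vanishes at 0. *)
Lemma kappa_variation_leP f g (C : R) :
  (joint_kappa_variation kappa a b f g <= C%:E)%E <->
  forall p, itv_partition a b p -> let x := nth b (a :: p) in
    \sum_(0 <= i < size p) joint_incr f g (x i) (x i.+1) <=
    \sum_(0 <= i < size p) C * kappa ((x i.+1 - x i) / (b - a)).
Proof.
have pos p : itv_partition a b p ->
    0 < \sum_(0 <= i < size p)
      kappa ((nth b (a :: p) i.+1 - nth b (a :: p) i) / (b - a)).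
  move=> pab; have p0 : (0 < size p)%N.
    case: p pab => // /itv_partition_nil ab'.
    by move: ab; rewrite ab' ltxx.
  have step i : (i < size p)%N ->
      0 < kappa ((nth b (a :: p) i.+1 - nth b (a :: p) i) / (b - a)).
    move=> ip; apply: kappa_length_gt0.
    - by apply: itv_partition_nth_ge => //; rewrite ltnS ltnW.
    - by case: pab => /(pathP b) + _; exact.
    - exact: itv_partition_nth_le.
  rewrite -(prednK p0) big_nat_recl//=.
  apply: ltr_pwDl; first exact: (step 0%N p0).
  rewrite big_nat; apply: sumr_ge0 => i /andP[_ ip]; apply/ltW/(step i.+1).
  by rewrite -(prednK p0) ltnS.
split=> [VC p pab /=|JC].
  rewrite -mulr_sumr -ler_pdivrMr; last exact: pos.
  rewrite -lee_fin; apply: le_trans VC.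
  by apply: ereal_sup_ubound; exists p.
apply: ge_ereal_sup => _ [p pab <-].
rewrite lee_fin ler_pdivrMr; last exact: pos.
by rewrite mulr_sumr; exact: JC.
Qed.

Lemma kappa_variation_potential f g (C : R) : 0 <= C ->
  (joint_kappa_variation kappa a b f g <= C%:E)%E ->
  exists2 w, potential a b (joint_incr f g)
               (fun s t => C * kappa ((t - s) / (b - a))) w &
             forall t, a <= t <= b -> `|w t| <= C.
Proof.
move=> C0 /kappa_variation_leP JC; apply: potential_exists => //.
  by move=> s t; exact: joint_incr_ge0.
move=> s t as_ st tb.
have := kappa01 (unit_length as_ (ltW st) tb); rewrite in_itv/= => /andP[k0 k1].
by rewrite mulr_ge0//= ler_piMr.
Qed.

(** Each sum of increments involves finitely many points, so the inequality
    between sums in [kappa_variation_leP] survives pointwise limits. *)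
Lemma kappa_variation_limit (f_ g_ : nat -> R -> M) f g (C : R) :
  pointwise_cvg_on `[a, b] f_ f -> pointwise_cvg_on `[a, b] g_ g ->
  (forall j, joint_kappa_variation kappa a b (f_ j) (g_ j) <= C%:E)%E ->
  (joint_kappa_variation kappa a b f g <= C%:E)%E.
Proof.
move=> ff gg VC; apply/kappa_variation_leP => p pab.
set x := nth b (a :: p); cbv zeta.
have xab i : (i < (size p).+1)%N -> `[a, b]%classic (x i).
  move=> ip; rewrite /= in_itv/=; apply/andP; split.
    exact: itv_partition_nth_ge.
  exact: itv_partition_nth_le.
have Jcvg : (\sum_(0 <= i < size p) joint_incr (f_ j) (g_ j) (x i) (x i.+1))
    @[j --> \oo] --> \sum_(0 <= i < size p) joint_incr f g (x i) (x i.+1).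
  rewrite big_nat; under eq_fun do rewrite big_nat.
  apply: cvg_big => [|i /andP[_ ip]]; first exact: add_continuous.
  have h0 := xab _ (ltnW (ip : (i.+1 < (size p).+1)%N)).
  have h1 := xab _ (ip : (i.+1 < (size p).+1)%N).
  exact: joint_incr_cvg (ff _ h0) (ff _ h1) (gg _ h0) (gg _ h1).
apply: (ler_cvg_to Jcvg (cvg_cst _)); apply: nearW => j.
by have /kappa_variation_leP/(_ p pab) := VC j.
Qed.

Lemma ordered_pairs_exists n : exists I, ordered_pairs `[a, b] n I.
Proof.
case: n => [|n]; first by exists (fun=> (a, b)); split.
pose h := (b - a) / n.+1%:R.
have h0 : 0 < h by rewrite divr_gt0 ?subr_gt0.
have hb i : (i <= n.+1)%N -> `[a, b]%classic (a + i%:R * h).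
  move=> ni; rewrite /= in_itv/= lerDl mulr_ge0 ?(ltW h0)//=.
  rewrite -lerBrDl /h mulrCA ger_pMr ?subr_gt0//.
  by rewrite ler_pdivrMr// mul1r ler_nat.
exists (fun i => (a + i%:R * h, a + i.+1%:R * h)); split => [i ni|i ni|i ni]/=.
- by split; apply: hb => //; exact: ltnW.
- by rewrite ltrD2l ltr_pM2r// ltr_nat.
- exact: lexx.
Qed.

(** For large n, the bound given by the potential with [e / 3] per interval is
    below [n * e]: the pairs and the gaps take [2 * (n * e / 3)], and the terms
    that do not grow with n fit into the remaining third. *)
Lemma kappa_variation_regular f g (C : R) : 0 <= C ->
  (joint_kappa_variation kappa a b f g <= C%:E)%E ->
  regularity_class `[a, b] g f.
Proof.
move=> C0 VC; have [w wP wC] := kappa_variation_potential C0 VC.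
have J0 s t : 0 <= joint_incr f g s t by exact: joint_incr_ge0.
have ub e : 0 < e -> exists2 L, 0 <= L &
    forall n, (joint_modulus `[a, b] n.+1 f g <=
               (2 * C + (n.+1).*2%:R * e + L * (b - a))%:E)%E.
  move=> e0; have [L L0 Le] := kappa_almost_linear C0 e0; exists L => // n.
  apply: ge_ereal_sup => _ [I Iab <-]; rewrite lee_fin.
  exact: (potential_ordered_pairs J0 (ltW e0) L0 wP wC Le Iab).
have ge0 n : (0 <= joint_modulus `[a, b] n f g)%E.
  have [I Iab] := ordered_pairs_exists n.
  apply: (@le_trans _ _
    (\sum_(0 <= i < n) joint_incr f g (I i).1 (I i).2)%:E).
    by rewrite lee_fin sumr_ge0.
  by apply: ereal_sup_ubound; exists I.
have fin n : (0 < n)%N -> joint_modulus `[a, b] n f g \is a fin_num.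
  case: n => // n _; have [L _ Lub] := ub 1 ltr01.
  by rewrite ge0_fin_numE// (le_lt_trans (Lub n))// ltry.
split=> //; apply/cvgrPdist_le => e e0.
have e30 : 0 < e / 3 by rewrite divr_gt0.
have [L L0 Lub] := ub _ e30.
pose K := 2 * C + L * (b - a).
have K0 : 0 <= K by rewrite addr_ge0 ?mulr_ge0// subr_ge0 ltW.
near=> n.
have n0 : (0 < n)%N by near: n; exact: nbhs_infty_gt.
have nR0 : 0 < n%:R :> R by rewrite ltr0n.
have Kn : K / (e / 3) <= n%:R by near: n; exact: nbhs_infty_ger.
rewrite sub0r normrN ger0_norm; last by rewrite divr_ge0// fine_ge0.
rewrite ler_pdivrMr// -lee_fin fineK; last exact: fin.
have nE : n = n.-1.+1 by rewrite prednK.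
move: Kn; rewrite nE => Kn.
apply: le_trans (Lub n.-1) _; rewrite lee_fin.
move: Kn; rewrite ler_pdivrMr// /K -muln2 natrM; lra.
Unshelve. all: end_near. Qed.

End kappa_variation.

Lemma limn_esup_lt_pinfty (R : realType) (u : nat -> \bar R) :
  (limn_esup u < +oo)%E ->
  exists2 C : R, 0 <= C & \forall j \near \oo, (u j <= C%:E)%E.
Proof.
move=> /ereal_inf_lt[_ [A A_oo <-] supA].
have uA j : A j -> (u j <= ereal_sup [set u x | x in A])%E.
  by move=> Aj; apply: ereal_sup_ubound; exists j.
move: supA uA; case: (ereal_sup _) => [r _|//|_] uA.
  exists (Num.max 0 r); first by rewrite le_max lexx.
  apply: filterS A_oo => j /uA /le_trans; apply.
  by rewrite lee_fin le_max lexx orbT.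
exists 0 => //; apply: filterS A_oo => j /uA /le_trans; apply.
exact: leNye.
Qed.

Theorem theorem4 (R : realType) (M : metricType R) (a b : R) (ab : a < b)
    (kappa : R -> R)
    (kappa01 : forall x, x \in `[0, 1] -> kappa x \in `[0, 1])
    (kappa_cont : {within `[0, 1], continuous kappa})
    (kappa_incr : {in `[0, 1] &, increasing_fun kappa})
    (kappa_conc : concave_on `[0, 1] kappa)
    (kappa0 : kappa 0 = 0) (kappa1 : kappa 1 = 1)
    (kappa_pinfty : kappa x / x @[x --> 0^'+] --> +oo)
    (f_ g_ : nat -> R -> M) (g : R -> M)
    (f_precompact : pointwise_precompact_on `[a, b] f_)
    (g_cvg : pointwise_cvg_on `[a, b] g_ g)
    (limsup_fin :
      (limn_esup (fun j => joint_kappa_variation kappa a b (f_ j) (g_ j))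
         < +oo)%E) :
  exists (sigma : nat -> nat) (f : R -> M),
    [/\ increasing_seq sigma,
        pointwise_cvg_on `[a, b] (f_ \o sigma) f,
        regularity_class `[a, b] g f &
        (joint_kappa_variation kappa a b f g < +oo)%E].
Proof.
have [C C0 [N _ VC]] := limn_esup_lt_pinfty limsup_fin.
(* Dropping the first [N] terms makes the bound [C] valid for all indices. *)
pose F := f_ \o addn^~ N; pose G := g_ \o addn^~ N.
have VFG j : (joint_kappa_variation kappa a b (F j) (G j) <= C%:E)%E.
  by apply: VC => /=; exact: leq_addl.
have Gcvg : pointwise_cvg_on `[a, b] G g.
  exact: pointwise_cvg_on_comp (cvg_addnr N) g_cvg.
have Fpre : pointwise_precompact_on `[a, b] F.
  move=> t tab; apply: (subclosed_compact _ (f_precompact t tab)).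
    exact: closed_closure.
  by apply: closure_subset => _ [j _ <-]; exists (j + N)%N.
have /choice[w wP] j : exists w,
    potential a b (joint_incr (F j) (G j))
      (fun s t => C * kappa ((t - s) / (b - a))) w /\
    forall t, a <= t <= b -> `|w t| <= C.
  have [w wP wC] :=
    kappa_variation_potential ab kappa01 kappa_incr kappa0 C0 (VFG j).
  by exists w.
have [sigma [f [sigma_incr Ff]]] := potential_selection Fpre Gcvg
  (kappa_almost_linear ab kappa01 kappa_cont kappa0 C0)
  (fun j => proj1 (wP j)) (fun j => proj2 (wP j)).
have Gsigma : pointwise_cvg_on `[a, b] (G \o sigma) g.
  exact: pointwise_cvg_on_comp (increasing_seq_cvg sigma_incr) Gcvg.
have VfgC : (joint_kappa_variation kappa a b f g <= C%:E)%E.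
  apply: (kappa_variation_limit ab kappa_incr kappa0 Ff Gsigma) => j.
  exact: VFG.
exists (fun k => sigma k + N)%N, f; split => //.
- by move=> m n; rewrite -sigma_incr !leEnat leq_add2r.
- exact: (kappa_variation_regular ab kappa01 kappa_cont kappa_incr kappa0 C0
    VfgC).
- exact: le_lt_trans VfgC (ltry C).
Qed.
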